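(* Let $\varepsilon>0$, let $\xi^1,\xi^2\in\{1,-1\}^N$ with $\xi^1\neq\pm\xi^2$, and let $C_{ij}=\xi^1_i\xi^1_j+\xi^2_i\xi^2_j$. Put $I_1=\{i : \xi^1_i=\xi^2_i\}$ and $I_2=\{i : \xi^1_i\neq\xi^2_i\}$, subsets of $\{1,\dots,N\}$. For $\eta\in\{1,-1\}^N$ let $\mathcal J_\eta$ be the $N\times N$ matrix with off-diagonal entries $(\mathcal J_\eta)_{ij}=\frac1N C_{ij}\eta_i\eta_j+\frac{2\varepsilon}{N}$ ($i\ne j$) and diagonal entries $(\mathcal J_\eta)_{ii}=-\frac1N\sum_{j\neq i}C_{ij}\eta_i\eta_j-\frac{2\varepsilon(N-1)}{N}$. Then for $\mathcal J_{\xi^1}$ (and $\mathcal J_{\xi^2}$), with the subspaces $V[\mathbb 1]$, $V(\cdot)$, $V(\cdot\,;\cdot)$ defined in the context, we have: (1) $0$ is a single eigenvalue with eigenspace $V[\mathbb 1]$; (2) $-2\big(\frac{|I_1|}{N}+\varepsilon\big)$ is an eigenvalue with eigenspace $V(I_1)$; (3) $-2\big(\frac{|I_2|}{N}+\varepsilon\big)$ is an eigenvalue with eigenspace $V(I_2)$; (4) $-2\varepsilon$ is a single eigenvalue with eigenspace $V(I_1;I_2)$.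
   Context: $\mathcal J_\eta$ is the Jacobian, at the bipolar equilibrium $\varphi^*(\eta)$ (phases $\varphi_i,\varphi_j$ equal mod $2\pi$ if $\eta_i=\eta_j$, differing by $\pi$ mod $2\pi$ if $\eta_i\neq\eta_j$), of the system $\dot\varphi_i=\frac1N\sum_{j=1}^N C_{ij}\sin(\varphi_j-\varphi_i)+\frac{\varepsilon}{N}\sum_{j=1}^N\sin2(\varphi_j-\varphi_i)$, $i=1,\dots,N$, with memories $\xi^1,\xi^2$. Subspaces of $\mathbb R^N$: $V[\mathbb 1]=\{k(1,\dots,1)^{\mathrm T}: k\in\mathbb R\}$. For $I\subset\{1,\dots,N\}$, $V(I)=\{x\in\mathbb R^N : x_i=0 \text{ for } i\notin I,\ \sum_{i\in I}x_i=0\}$. For disjoint $I,\hat I\subset\{1,\dots,N\}$, $V(I;\hat I)=\{k x^\star : k\in\mathbb R\}$ with $x^\star_i=|\hat I|$ for $i\in I$, $x^\star_i=-|I|$ for $i\in\hat I$, $x^\star_i=0$ otherwise; if $I$ or $\hat I$ is empty, $V(I;\hat I)=\{0\}$. ''Single'' eigenvalue means an eigenvalue of multiplicity one.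
   Formalization: In (2) and (3), ''is an eigenvalue'' is claimed only when |I_k| ≥ 2 (for |I_k| = 1 the space V(I_k) is {0} and the value is not an eigenvalue); when |I_1| = |I_2| the two values coincide and the eigenspace is V(I_1)+V(I_2). *)

(* Defs.v *)
From HB Require Import structures.
From mathcomp Require Import all_boot all_order all_algebra.
From mathcomp Require Import reals.

Set Implicit Arguments.
Unset Strict Implicit.
Unset Printing Implicit Defensive.

Import GRing.Theory passmx.
Local Open Scope ring_scope.

Definition is_sign_vector (R : realType) (N : nat) (x : 'cV[R]_N) : Prop :=
  forall i, x i 0 = 1 \/ x i 0 = - 1.

Definition coupling (R : realType) (N : nat) (xi1 xi2 : 'cV[R]_N) : 'M[R]_N :=
  \matrix_(i, j) (xi1 i 0 * xi1 j 0 + xi2 i 0 * xi2 j 0).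

Definition jacobian (R : realType) (N : nat) (eps : R) (C : 'M[R]_N)
    (eta : 'cV[R]_N) : 'M[R]_N :=
  \matrix_(i, j)
    if i == j
    then - (N%:R^-1 * \sum_(k < N | k != i) C i k * eta i 0 * eta k 0)
         - 2 * eps * (N%:R - 1) / N%:R
    else N%:R^-1 * C i j * eta i 0 * eta j 0 + 2 * eps / N%:R.

(* [eigenspace] of matrices is about row vectors; going through an endomorphism
   of ['cV[R]_N] makes [leigenspace] consist of the columns with M x = a x. *)
Definition mx_endo (R : realType) (N : nat) (M : 'M[R]_N) : 'End('cV[R]_N) :=
  linfun (mulmx M : 'cV[R]_N -> 'cV[R]_N).

(* An eigenvalue of (algebraic) multiplicity one. *)
Definition single_eigenvalue (R : realType) (N : nat) (M : 'M[R]_N) (a : R) :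
    Prop :=
  leigenvalue (mx_endo M) a /\ mup a (char_poly M) = 1%N.

Definition agree_set (R : realType) (N : nat) (xi1 xi2 : 'cV[R]_N) :
    {set 'I_N} :=
  [set i | xi1 i 0 == xi2 i 0].

Definition differ_set (R : realType) (N : nat) (xi1 xi2 : 'cV[R]_N) :
    {set 'I_N} :=
  [set i | xi1 i 0 != xi2 i 0].

Definition Vone (R : realType) (N : nat) : {vspace 'cV[R]_N} :=
  <[const_mx 1]>%VS.

Definition coord_fun (R : realType) (N : nat) (i : 'I_N) (x : 'cV[R]_N) : R^o :=
  x i 0.

Definition sum_fun (R : realType) (N : nat) (I : {set 'I_N}) (x : 'cV[R]_N) :
    R^o :=
  \sum_(i in I) x i 0.

Fact coord_fun_is_linear (R : realType) (N : nat) (i : 'I_N) :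
  linear (@coord_fun R N i).
Proof. by move=> a x y; rewrite /coord_fun !mxE. Qed.

HB.instance Definition _ (R : realType) (N : nat) (i : 'I_N) :=
  GRing.isLinear.Build R 'cV[R]_N R^o _ (@coord_fun R N i)
    (coord_fun_is_linear i).

Fact sum_fun_is_linear (R : realType) (N : nat) (I : {set 'I_N}) :
  linear (@sum_fun R N I).
Proof.
move=> a x y; rewrite /sum_fun scaler_sumr -big_split /=.
by apply: eq_bigr => i _; rewrite !mxE.
Qed.

HB.instance Definition _ (R : realType) (N : nat) (I : {set 'I_N}) :=
  GRing.isLinear.Build R 'cV[R]_N R^o _ (@sum_fun R N I) (sum_fun_is_linear I).

Definition Vset (R : realType) (N : nat) (I : {set 'I_N}) : {vspace 'cV[R]_N} :=
  (lker (linfun (@sum_fun R N I))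
   :&: \bigcap_(i | i \notin I) lker (linfun (@coord_fun R N i)))%VS.

Definition xstar (R : realType) (N : nat) (I J : {set 'I_N}) : 'cV[R]_N :=
  \col_i (if i \in I then #|J|%:R else if i \in J then - #|I|%:R else 0).

Definition Vpair (R : realType) (N : nat) (I J : {set 'I_N}) :
    {vspace 'cV[R]_N} :=
  if (I == set0) || (J == set0) then 0%VS else <[xstar R I J]>%VS.

Lemma VsetP (R : realType) (N : nat) (I : {set 'I_N}) (x : 'cV[R]_N) :
  reflect ((forall i, i \notin I -> x i 0 = 0) /\ \sum_(i in I) x i 0 = 0)
          (x \in Vset R I).
Proof.
rewrite memv_cap memv_ker lfunE /=.
apply: (iffP andP) => -[].
  move=> /eqP sx /subv_bigcapP cx; split=> // i iI.
  by have := cx i iI; rewrite -memvE memv_ker lfunE => /eqP.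
move=> cx sx; split; first exact/eqP.
by apply/subv_bigcapP => i iI; rewrite -memvE memv_ker lfunE; apply/eqP/cx.
Qed.

Lemma mem_leigenspace_mx (R : realType) (N : nat) (M : 'M[R]_N) (a : R)
    (x : 'cV[R]_N) :
  (x \in leigenspace (mx_endo M) a) = (M *m x == a *: x).
Proof.
by rewrite memv_ker add_lfunE opp_lfunE scale_lfunE id_lfunE lfunE subr_eq0.
Qed.

(* Main.v *)
(* As C_ij eta_i eta_j is 2 when i and j lie in the same block of the partition
   {I1, I2} and 0 otherwise, (J x)_i is 2/N (S_c - |c| x_i) + 2eps/N (S - N x_i)
   where c is the block of i, S_c the sum of x over c and S its total sum.
   Summing J x = l x over a block and over all indices determines S and the S_c,
   and then x itself.  The eigenvalues 0 and -2 eps are algebraically simple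
   because J is symmetric: if the eigenspace is the line of v, then v^T is also
   a left eigenvector with v^T v <> 0, and replacing J by J + v v^T moves
   exactly one copy of the eigenvalue elsewhere and leaves none behind. *)
Require Import Defs.
From mathcomp Require Import all_boot all_order all_algebra.
From mathcomp Require Import reals.
From mathcomp Require Import ring lra.
Import passmx.

Set Implicit Arguments.
Unset Strict Implicit.
Unset Printing Implicit Defensive.

Import Order.TTheory GRing.Theory Num.Theory.
Local Open Scope ring_scope.

(** * Rank-one updates and algebraic multiplicity *)

Lemma det_rank1_update (T : comNzRingType) (n : nat) (A : 'M[T]_n)
    (v : 'cV[T]_n) (u : 'rV[T]_n) (y : T) :
  A *m v = y *: v ->
  \det (A - v *m u) * y = \det A * (y - (u *m v) 0 0).
Proof.
move=> Av.
(* The determinant of one bordered matrix is computed twice: here its corner is cleared using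
   [A *m v = y *: v], and in [F] it is factored by blocks. Neither inverts [A] or [y], so polynomial
   entries are allowed. *)
have E : block_mx A v u 1%:M *m block_mx 1%:M (- v) 0 y%:M =
         block_mx A 0 u (y - (u *m v) 0 0)%:M.
  rewrite mulmx_block !mulmx1 !mulmx0 !addr0 mul1mx !mulmxN Av mul_mx_scalar.
  by rewrite addNr raddfB /= -mx11_scalar addrC.
have F : block_mx A v u 1%:M =
         block_mx (A - v *m u) v 0 1%:M *m block_mx 1%:M 0 u 1%:M.
  by rewrite mulmx_block !mulmx1 !mulmx0 !mul1mx !add0r subrK.
move: (congr1 determinant E); rewrite F !det_mulmx det_lblock !det_ublock.
by rewrite det_lblock !det1 !mulr1 !mul1r !det_scalar1.
Qed.

(* Brauer's deflation: adding v u to A moves the root a of the characteristic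
   polynomial to a + u v and leaves the other roots in place. *)
Lemma char_poly_deflation (F : fieldType) (n : nat) (A : 'M[F]_n) (a : F)
    (v : 'cV[F]_n) (u : 'rV[F]_n) :
  A *m v = a *: v ->
  char_poly (A + v *m u) * ('X - a%:P)
    = char_poly A * ('X - (a + (u *m v) 0 0)%:P).
Proof.
move=> Av; rewrite /char_poly polyCD opprD addrA.
have -> : char_poly_mx (A + v *m u) =
          char_poly_mx A - map_mx polyC v *m map_mx polyC u.
  by rewrite /char_poly_mx map_mxD map_mxM /= opprD addrA.
have -> : ((u *m v) 0 0)%:P = (map_mx polyC u *m map_mx polyC v) 0 0.
  by rewrite -map_mxM [RHS]mxE.
apply: det_rank1_update.
rewrite /char_poly_mx mulmxBl mul_scalar_mx -map_mxM Av scalerBl.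
by rewrite map_mxZ.
Qed.

(** By deflation it suffices that [a] is not an eigenvalue of [A + v *m u]. A left eigenvector [w]
    of that matrix at [a] satisfies [w *m v = 0], so it is one of [A] and a multiple of [u]; since
    [u *m v] is nonzero, [w = 0]. *)
Lemma mup_char_poly_eq1 (F : fieldType) (n : nat) (A : 'M[F]_n) (a : F)
    (v : 'cV[F]_n) (u : 'rV[F]_n) :
  A *m v = a *: v -> (u *m v) 0 0 != 0 ->
  (forall w : 'rV[F]_n, w *m A = a *: w -> exists k, w = k *: u) ->
  mup a (char_poly A) = 1%N.
Proof.
move=> Av uv0 span.
have shift : ~~ root ('X - (a + (u *m v) 0 0)%:P) a.
  by rewrite root_XsubC -subr_eq0 opprD addrA subrr sub0r oppr_eq0.
rewrite -(mupMl _ shift) -char_poly_deflation // mupMr.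
  by rewrite (mup_XsubCX 1) eqxx.
rewrite -eigenvalue_root_char; apply/negP => /eigenvalueP[w wA].
move: wA; rewrite mulmxDr mulmxA => wA.
have wv0 : w *m v = 0.
  have := congr1 (mulmx^~ v) wA.
  rewrite /= mulmxDl -!mulmxA Av -scalemxAl -scalemxAr => /eqP.
  rewrite -subr_eq0 addrC addKr mulmxA [u *m v]mx11_scalar mul_mx_scalar.
  by rewrite scaler_eq0 (negPf uv0) => /eqP.
move: wA; rewrite wv0 mul0mx addr0 => /span[k wE].
move: wv0; rewrite wE -scalemxAl [u *m v]mx11_scalar => /eqP.
rewrite scaler_eq0 -scalemx1 scaler_eq0 (negPf uv0) oner_eq0 !orbF.
by move=> /eqP ->; rewrite scale0r eqxx.
Qed.

Lemma single_eigenvalue_symmetric (R : realType) (N : nat) (M : 'M[R]_N)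
    (a : R) (v : 'cV[R]_N) :
  M^T = M -> v != 0 -> leigenspace (mx_endo M) a = <[v]>%VS ->
  single_eigenvalue M a.
Proof.
move=> Msym v0 E; split; first by rewrite /leigenvalue E -dimv_eq0 dim_vline v0.
have Mv : M *m v = a *: v.
  by apply/eqP; rewrite -mem_leigenspace_mx E memv_line.
apply: (@mup_char_poly_eq1 _ _ _ _ v v^T) => // [|w wM].
  (* [v^T *m v] is a sum of squares of reals, so it vanishes only for [v = 0]. *)
  apply: contraNneq v0; rewrite mxE => /eqP.
  under eq_bigr do rewrite mxE -expr2.
  rewrite psumr_eq0 => [/allP z|i _]; last exact: sqr_ge0.
  apply/eqP/colP => i; rewrite mxE.
  by have := z i (mem_index_enum _); rewrite /= sqrf_eq0 => /eqP.
have : w^T \in <[v]>%VS.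
  by rewrite -E mem_leigenspace_mx -{1}Msym -trmx_mul wM linearZ.
by move=> /vlineP[k wE]; exists k; rewrite -[w]trmxK wE linearZ.
Qed.

(** * The two-block form of the Jacobian *)

Definition block {N : nat} (I : {set 'I_N}) (i : 'I_N) : {set 'I_N} :=
  if i \in I then I else ~: I.

Lemma in_block (N : nat) (I : {set 'I_N}) (i j : 'I_N) :
  (j \in block I i) = ((j \in I) == (i \in I)).
Proof. by rewrite /block; case: (i \in I); rewrite ?inE; case: (j \in I). Qed.

(** Minus the Laplacian of a complete graph with edge weight [2 * eps / N], increased by [2 / N]
    inside each block. The loop weight at [i] enters both the entry and the degree subtracted from
    it, so it cancels. *)
Definition two_block (R : realType) (N : nat) (eps : R) (I : {set 'I_N}) :
    'M[R]_N :=
  \matrix_(i, j) (2 / N%:R * (j \in block I i)%:R + 2 * eps / N%:R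
    - (i == j)%:R * (2 / N%:R * #|block I i|%:R + 2 * eps)).

Lemma blockC (N : nat) (I : {set 'I_N}) : block (~: I) =1 block I.
Proof. by move=> i; rewrite /block inE setCK; case: (i \in I). Qed.

Lemma two_blockC (R : realType) (N : nat) (eps : R) (I : {set 'I_N}) :
  two_block eps (~: I) = two_block eps I.
Proof. by apply/matrixP => i j; rewrite !mxE !blockC. Qed.

Lemma tr_two_block (R : realType) (N : nat) (eps : R) (I : {set 'I_N}) :
  (two_block eps I)^T = two_block eps I.
Proof.
apply/matrixP => i j; rewrite !mxE !in_block [(i \in I) == _]eq_sym.
by case: (eqVneq i j) => [->|ij]; rewrite ?eqxx // !mul0r.
Qed.

(** For [eta = xi1] the product is 1 plus [(xi1_i xi2_i) (xi1_j xi2_j)], and [xi1_i xi2_i] is the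
    sign that tells the block of [i]; the case of [xi2] is symmetric. Hence both memories share one
    Jacobian. *)
Lemma coupling_sign (R : realType) (N : nat) (xi1 xi2 eta : 'cV[R]_N)
    (i j : 'I_N) :
  is_sign_vector xi1 -> is_sign_vector xi2 -> eta = xi1 \/ eta = xi2 ->
  coupling xi1 xi2 i j * eta i 0 * eta j 0
    = 2 * (j \in block (agree_set xi1 xi2) i)%:R.
Proof.
move=> s1 s2 Eeta; rewrite in_block !inE mxE.
have one : (1 == - 1 :> R) = false by apply/eqP; lra.
have Eone : (- 1 == 1 :> R) = false by apply/eqP; lra.
by case: Eeta => ->; case: (s1 i) => ->; case: (s1 j) => ->;
   case: (s2 i) => ->; case: (s2 j) => ->; rewrite ?eqxx ?one ?Eone /=; lra.
Qed.

Lemma jacobian_two_block (R : realType) (N : nat) (eps : R)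
    (xi1 xi2 eta : 'cV[R]_N) :
  is_sign_vector xi1 -> is_sign_vector xi2 -> eta = xi1 \/ eta = xi2 ->
  jacobian eps (coupling xi1 xi2) eta = two_block eps (agree_set xi1 xi2).
Proof.
move=> s1 s2 Eeta; apply/matrixP => i j.
have N0 : N%:R != 0 :> R by rewrite pnatr_eq0; case: (N) i => [[]|].
rewrite [LHS]mxE [RHS]mxE; case: eqP => [<-|_]; last first.
  by rewrite -!mulrA [in X in _ * X]mulrA coupling_sign // mul0r subr0; field.
under eq_bigr do rewrite coupling_sign //.
(* The index [i] lies in its own block but is skipped by the sum, whence the [- 2]. *)
have -> : \sum_(k < N | k != i) 2 * (k \in block (agree_set xi1 xi2) i)%:R
   = 2 * #|block (agree_set xi1 xi2) i|%:R - 2 :> R.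
  have iB : i \in block (agree_set xi1 xi2) i by rewrite in_block.
  rewrite -sum1_card natr_sum mulr_sumr [in RHS](bigD1 i) //=.
  rewrite mulr1 addrAC subrr add0r.
  rewrite big_mkcond [RHS]big_mkcond /=.
  apply: eq_bigr => k _.
  by case: (k == i); case: (k \in _); rewrite /= ?mulr0 ?mulr1.
by rewrite in_block eqxx /=; field.
Qed.

(** * Action on vectors and on block sums *)

Lemma mul_two_block (R : realType) (N : nat) (eps : R) (I : {set 'I_N})
    (x : 'cV[R]_N) (i : 'I_N) :
  (two_block eps I *m x) i 0
  = 2 / N%:R * (\sum_(j in block I i) x j 0 - #|block I i|%:R * x i 0)
    + 2 * eps / N%:R * (\sum_j x j 0 - N%:R * x i 0).
Proof.
have N0 : N%:R != 0 :> R by rewrite pnatr_eq0; case: (N) i => [[]|].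
rewrite mxE (eq_bigr (fun j => 2 / N%:R * (if j \in block I i then x j 0 else 0)
  + 2 * eps / N%:R * x j 0
  - (2 / N%:R * #|block I i|%:R + 2 * eps) * (if j == i then x j 0 else 0))).
  by rewrite sumrB big_split /= -!mulr_sumr -!big_mkcond /= big_pred1_eq; field.
move=> j _; rewrite mxE eq_sym.
by case: (j \in _); case: (j == i); rewrite /=; ring.
Qed.

Lemma sum_split_setC (R : realType) (N : nat) (I : {set 'I_N}) (x : 'cV[R]_N) :
  \sum_j x j 0 = \sum_(j in I) x j 0 + \sum_(j in ~: I) x j 0.
Proof.
by rewrite (bigID (mem I)) /=; congr (_ + _); apply: eq_bigl => j; rewrite inE.
Qed.

(** If [I] or its complement is empty, it is the block of no index, but its sum is then empty. *)
Lemma sum_blocks_eq0 (R : realType) (N : nat) (I : {set 'I_N}) (x : 'cV[R]_N) :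
  (forall i, \sum_(j in block I i) x j 0 = 0) ->
  \sum_(j in I) x j 0 = 0 /\ \sum_(j in ~: I) x j 0 = 0.
Proof.
move=> H; split.
  have [->|[i iI]] := set_0Vmem I; first by rewrite big_set0.
  by have := H i; rewrite /block iI.
have [->|[i]] := set_0Vmem (~: I); first by rewrite big_set0.
by rewrite inE => /negPf iI; have := H i; rewrite /block iI.
Qed.

(** The in-block terms [S_I - #|I| x_j] add up to zero over [I], so only the [eps] coupling
    survives. *)
Lemma sum_set_two_block (R : realType) (N : nat) (eps : R) (I : {set 'I_N})
    (x : 'cV[R]_N) :
  (0 < N)%N ->
  \sum_(j in I) (two_block eps I *m x) j 0
  = 2 * eps * (#|I|%:R / N%:R * \sum_j x j 0 - \sum_(j in I) x j 0).
Proof.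
rewrite lt0n -(pnatr_eq0 R) => N0.
rewrite (eq_bigr (fun j =>
  2 / N%:R * (\sum_(k in I) x k 0 - #|I|%:R * x j 0)
    + 2 * eps / N%:R * (\sum_k x k 0 - N%:R * x j 0))); last first.
  by move=> j Ij; rewrite mul_two_block /block Ij.
rewrite big_split /= -!mulr_sumr !sumrB -!mulr_sumr !sumr_const.
by field.
Qed.

Lemma sum_block_two_block (R : realType) (N : nat) (eps : R) (I : {set 'I_N})
    (x : 'cV[R]_N) (i : 'I_N) :
  \sum_(j in block I i) (two_block eps I *m x) j 0
  = 2 * eps * (#|block I i|%:R / N%:R * \sum_j x j 0
               - \sum_(j in block I i) x j 0).
Proof.
have N0 : (0 < N)%N by case: (N) i => [[]|].
rewrite /block; case: (i \in I); first exact: sum_set_two_block.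
by rewrite -two_blockC sum_set_two_block.
Qed.

Lemma sum_two_block (R : realType) (N : nat) (eps : R) (I : {set 'I_N})
    (x : 'cV[R]_N) :
  (0 < N)%N -> \sum_j (two_block eps I *m x) j 0 = 0.
Proof.
move=> N0; rewrite (sum_split_setC I) -{2}two_blockC !sum_set_two_block //.
rewrite (sum_split_setC I x) [#|~: I|]cardsCs setCK card_ord.
rewrite natrB; last by rewrite -[leqRHS]card_ord max_card.
by field; rewrite pnatr_eq0 -lt0n.
Qed.

(** * Eigenspaces of the two-block matrix *)

Section Spectrum.
Context (R : realType) (N : nat) (eps : R) (I : {set 'I_N}).
Hypotheses (eps_gt0 : 0 < eps) (N_gt0 : (0 < N)%N).
Implicit Type x : 'cV[R]_N.
Let B := two_block eps I.

Let NR_gt0 : 0 < N%:R :> R. Proof. by rewrite ltr0n. Qed.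

Let card_block_gt0 i : 0 < #|block I i|%:R :> R.
Proof. by rewrite ltr0n; apply/card_gt0P; exists i; rewrite in_block. Qed.

Let eigenvector_eqs x l : B *m x = l *: x ->
  l * \sum_j x j 0 = 0 /\
  forall i,
   l * \sum_(j in block I i) x j 0
     = 2 * eps * (#|block I i|%:R / N%:R * \sum_j x j 0
               - \sum_(j in block I i) x j 0) /\
   l * x i 0 =
    2 / N%:R * (\sum_(j in block I i) x j 0 - #|block I i|%:R * x i 0)
    + 2 * eps / N%:R * (\sum_j x j 0 - N%:R * x i 0).
Proof.
move=> Bx; have coef j : l * x j 0 = (B *m x) j 0 by rewrite Bx mxE.
split; first by rewrite mulr_sumr (eq_bigr _ (fun j _ => coef j)) sum_two_block.
move=> i; rewrite coef mul_two_block; split=> //.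
by rewrite mulr_sumr (eq_bigr _ (fun j _ => coef j)) sum_block_two_block.
Qed.

Lemma leigenspace_two_block_0 : leigenspace (mx_endo B) 0 = Vone R N.
Proof.
apply/vspaceP => x; rewrite mem_leigenspace_mx.
apply/eqP/vlineP => [/eigenvector_eqs[_ eqs]|[k ->]]; last first.
  rewrite scale0r; apply/colP => i; rewrite mul_two_block !mxE.
  under eq_bigr do rewrite !mxE.
  under [\sum_j _]eq_bigr do rewrite !mxE.
  by rewrite !sumr_const card_ord; ring.
(* The witness is the mean [S / N]: the block equation gives [S_c = |c| S / N], which turns the
   equation at [i] into [2 (|c| / N + eps) (S / N - x_i) = 0]. *)
exists ((\sum_j x j 0) / N%:R); apply/colP => i; rewrite !mxE mulr1.
have [/esym/eqP] := eqs i; rewrite !mul0r mulf_eq0 gt_eqF ?mulr_gt0 //=.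
rewrite subr_eq0 => /eqP <- E.
have D0 : 0 < 2 * (#|block I i|%:R / N%:R + eps).
  by rewrite mulr_gt0 ?addr_gt0 ?divr_gt0.
apply: (mulfI (lt0r_neq0 D0)); rewrite -[LHS]addr0 [X in _ + X = _]E.
by field; exact: lt0r_neq0.
Qed.

(** At [- 2 * eps] the total sum vanishes and the [eps] terms cancel in the equation at [i], leaving
    [S_c = |c| x_i]: the vector is constant on each block, with opposite block sums. *)
Lemma leigenspace_two_block_pair : I != set0 -> ~: I != set0 ->
  leigenspace (mx_endo B) (- 2 * eps) = Vpair R I (~: I).
Proof.
move=> I0 I'0; rewrite /Vpair (negPf I0) (negPf I'0) /=.
have a0 : #|I|%:R != 0 :> R by rewrite pnatr_eq0 cards_eq0.
have b0 : #|~: I|%:R != 0 :> R by rewrite pnatr_eq0 cards_eq0.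
apply/vspaceP => x; rewrite mem_leigenspace_mx.
apply/eqP/vlineP => [/eigenvector_eqs[S0 eqs]|[k ->]]; last first.
  have S1 : \sum_(j in I) (k *: xstar R I (~: I)) j 0
            = k * #|~: I|%:R * #|I|%:R.
    rewrite mulr_natr -sumr_const.
    by apply: eq_bigr => j Ij; rewrite !mxE Ij.
  have S2 : \sum_(j in ~: I) (k *: xstar R I (~: I)) j 0
            = k * - #|I|%:R * #|~: I|%:R.
    rewrite mulr_natr -sumr_const; apply: eq_bigr => j.
    by rewrite !mxE inE => /[dup] /negPf -> ->.
  apply/colP => i; rewrite mul_two_block (sum_split_setC I) S1 S2 /block.
  have N0 := lt0r_neq0 NR_gt0.
  by case: ifP => iI; rewrite ?S1 ?S2 !mxE inE iI /=; field.
move: S0 => /eqP; rewrite mulf_eq0 mulf_eq0 oppr_eq0 pnatr_eq0 /= gt_eqF //=.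
rewrite (sum_split_setC I) addr_eq0 => /eqP S0.
(* Chosen so that its product with [#|~: I|] is the mean of [x] over [I]. *)
exists ((\sum_(j in I) x j 0) / (#|I|%:R * #|~: I|%:R)); apply/colP => i.
have [_] := eqs i; rewrite (sum_split_setC I) S0 addNr => E.
have N0 := lt0r_neq0 NR_gt0.
have Sc : \sum_(j in block I i) x j 0 = #|block I i|%:R * x i 0.
  apply/eqP; rewrite -subr_eq0.
  (* The right-hand side is [N / 2] times the difference of the two sides of [E]. *)
  have -> : \sum_(j in block I i) x j 0 - #|block I i|%:R * x i 0
    = N%:R / 2 * (2 / N%:R * (\sum_(j in block I i) x j 0
                              - #|block I i|%:R * x i 0)
        + 2 * eps / N%:R * (0 - N%:R * x i 0) - - 2 * eps * x i 0) by field.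
  by rewrite E subrr mulr0.
rewrite !mxE inE; move: Sc; rewrite /block; case: ifP => iI /= Sc.
  by rewrite -S0 Sc; field; rewrite b0.
by rewrite Sc; field; rewrite b0.
Qed.

Let lambda := - 2 * (#|I|%:R / N%:R + eps).

(** As [lambda] is negative, [S = 0]; the block equation becomes [|I| S_c = 0], and the one at [i]
    becomes [(|c| - |I|) x_i = 0]. Comparing sizes rather than blocks treats equal and unequal
    blocks together. *)
Lemma mem_leigenspace_two_block x : I != set0 ->
  x \in leigenspace (mx_endo B) lambda <->
  forall i, \sum_(j in block I i) x j 0 = 0 /\
            (#|block I i| <> #|I| -> x i 0 = 0).
Proof.
rewrite -card_gt0 -(ltr0n R) mem_leigenspace_mx => I0.
have N0 := lt0r_neq0 NR_gt0; split.
  move=> /eqP/eigenvector_eqs[S0 eqs] i.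
  move: S0 => /eqP; rewrite mulf_eq0 mulf_eq0 oppr_eq0 pnatr_eq0 /=.
  rewrite gt_eqF; last first.
    by rewrite addr_gt0 ?divr_gt0.
  move=> /eqP S0; have := eqs i; rewrite S0 => -[E1 E2].
  have Sc : \sum_(j in block I i) x j 0 = 0.
    apply: (mulfI (lt0r_neq0 I0)); rewrite mulr0.
    have -> : #|I|%:R * \sum_(j in block I i) x j 0 = - N%:R / 2 *
      (- 2 * (#|I|%:R / N%:R + eps) * \sum_(j in block I i) x j 0
        - 2 * eps * (#|block I i|%:R / N%:R * 0
                        - \sum_(j in block I i) x j 0)) by field.
    by rewrite E1 subrr mulr0.
  split=> // cI; apply/eqP.
  have : (#|block I i|%:R - #|I|%:R) * x i 0 = 0.
    rewrite [LHS](_ : _ = N%:R / 2 *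
     (- 2 * (#|I|%:R / N%:R + eps) * x i 0 -
      (2 / N%:R * (0 - #|block I i|%:R * x i 0)
        + 2 * eps / N%:R * (0 - N%:R * x i 0)))); last by field.
    by rewrite E2 Sc subrr mulr0.
  by move=> /eqP; rewrite mulf_eq0 subr_eq0 eqr_nat => /predU1P[].
move=> H; have S0 : \sum_j x j 0 = 0.
  have [] := sum_blocks_eq0 (fun i => proj1 (H i)).
  by rewrite (sum_split_setC I) => -> ->; rewrite addr0.
apply/eqP/colP => i; rewrite mul_two_block mxE S0; have [-> ci] := H i.
have [->|/eqP/ci ->] := eqVneq #|block I i| #|I|.
  by rewrite /lambda; field.
by rewrite !mulr0 !subr0 !mulr0 addr0.
Qed.

Lemma Vset_sub_leigenspace :
  I != set0 -> (Vset R I <= leigenspace (mx_endo B) lambda)%VS.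
Proof.
move=> I0; apply/subvP => x /VsetP[x0 S0].
apply/(mem_leigenspace_two_block _ I0) => i; split.
  rewrite /block; case: ifP => // iI.
  by rewrite big1 // => j; rewrite inE; exact: x0.
by rewrite /block; case: ifPn => // iI _; exact: x0.
Qed.

Lemma leigenspace_two_block_neq : I != set0 -> #|I| <> #|~: I| ->
  leigenspace (mx_endo B) lambda = Vset R I.
Proof.
move=> I0 neqI; apply/eqP; rewrite eqEsubv Vset_sub_leigenspace // andbT.
apply/subvP => x /(mem_leigenspace_two_block _ I0) H; apply/VsetP; split.
  move=> i /negPf iI; apply: (proj2 (H i)); rewrite /block iI; exact/nesym.
by have [] := sum_blocks_eq0 (fun i => proj1 (H i)).
Qed.

(** Two distinct indices of [I] give the nonzero vector [e_i - e_j] of [Vset R I]; for a singleton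
    [I] that space is zero. *)
Lemma leigenvalue_two_block : (1 < #|I|)%N -> leigenvalue (mx_endo B) lambda.
Proof.
move=> /[dup] I1 /card_gt1P[i [j [iI jI ij]]].
have I0 : I != set0 by rewrite -card_gt0 ltnW.
pose x : 'cV[R]_N := delta_mx i 0 - delta_mx j 0.
have xV : x \in Vset R I.
  apply/VsetP; split=> [k kI|].
    rewrite !mxE !andbT; have [ki|_] := eqVneq k i.
      by rewrite ki iI in kI.
    by have [kj|_] := eqVneq k j; rewrite ?subr0 //; rewrite kj jI in kI.
  have sum_delta k : k \in I -> \sum_(l in I) (l == k)%:R = 1 :> R.
    by move=> kI; rewrite (bigD1 k) //= eqxx big1 ?addr0 // =>
      l /andP[_ /negPf ->].
  under eq_bigr do rewrite !mxE !andbT.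
  by rewrite sumrB !sum_delta // subrr.
have := subvP (Vset_sub_leigenspace I0) _ xV.
rewrite /leigenvalue; apply: contraTneq => ->.
rewrite memv0; apply/eqP => /colP/(_ i) /eqP; rewrite !mxE !eqxx (negPf ij) /=.
by rewrite subr0 oner_eq0.
Qed.

End Spectrum.

(** With blocks of equal size no entry is forced to vanish: only the two block sums are zero, and
    [x] is the sum of its restrictions to the blocks. *)
Lemma leigenspace_two_block_eq (R : realType) (N : nat) (eps : R)
    (I : {set 'I_N}) :
  0 < eps -> I != set0 -> ~: I != set0 -> #|I| = #|~: I| ->
  leigenspace (mx_endo (two_block eps I)) (- 2 * (#|I|%:R / N%:R + eps))
    = (Vset R I + Vset R (~: I))%VS.
Proof.
move=> eps0 I0 I'0 eqI.
have N0 : (0 < N)%N by case/set0Pn: I0 => i _; case: (N) i => [[]|].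
apply/eqP; rewrite eqEsubv subv_add Vset_sub_leigenspace //=.
rewrite -[two_block eps I]two_blockC eqI Vset_sub_leigenspace // andbT.
rewrite -eqI two_blockC; apply/subvP => x /mem_leigenspace_two_block H.
have [SI SI'] := sum_blocks_eq0 (fun i => proj1 (H eps0 N0 I0 i)).
apply/memv_addP.
exists (\col_i (if i \in I then x i 0 else 0)).
  apply/VsetP; split=> [i /negPf iI|]; first by rewrite mxE iI.
  by rewrite -[RHS]SI; apply: eq_bigr => i iI; rewrite mxE iI.
exists (\col_i (if i \in ~: I then x i 0 else 0)).
  apply/VsetP; split=> [i /negPf iI|]; first by rewrite mxE iI.
  by rewrite -[RHS]SI'; apply: eq_bigr => i iI; rewrite mxE iI.
by apply/colP => i; rewrite !mxE inE; case: (i \in I); rewrite ?addr0 ?add0r.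
Qed.

(** * The spectrum at the two memories *)

Lemma setC_agree_set (R : realType) (N : nat) (xi1 xi2 : 'cV[R]_N) :
  ~: agree_set xi1 xi2 = differ_set xi1 xi2.
Proof. by apply/setP => i; rewrite !inE. Qed.

(** When [I1] and [I2] have equal size, [lambda1 = lambda2] and the common eigenspace is the sum of
    both spaces. A singleton block has zero [Vset], hence the size condition in the eigenvalue
    claims. *)
Theorem proposition2p1 (R : realType) (N : nat) (eps : R) (xi1 xi2 : 'cV[R]_N)
    (eps_gt0 : 0 < eps)
    (xi1_sign : is_sign_vector xi1) (xi2_sign : is_sign_vector xi2)
    (xi12_neq : xi1 <> xi2) (xi12_neqN : xi1 <> - xi2)
    (eta : 'cV[R]_N) (eta_mem : eta = xi1 \/ eta = xi2) :
  let I1 := agree_set xi1 xi2 in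
  let I2 := differ_set xi1 xi2 in
  let J := jacobian eps (coupling xi1 xi2) eta in
  let lambda1 := - 2 * (#|I1|%:R / N%:R + eps) in
  let lambda2 := - 2 * (#|I2|%:R / N%:R + eps) in
  [/\ (* (1) *)
      single_eigenvalue J 0 /\ leigenspace (mx_endo J) 0 = Vone R N,
      (* (2) *)
      [/\ (1 < #|I1|)%N -> leigenvalue (mx_endo J) lambda1,
          #|I1| <> #|I2| -> leigenspace (mx_endo J) lambda1 = Vset R I1 &
          #|I1| = #|I2| ->
            leigenspace (mx_endo J) lambda1 = (Vset R I1 + Vset R I2)%VS],
      (* (3) *)
      [/\ (1 < #|I2|)%N -> leigenvalue (mx_endo J) lambda2,
          #|I1| <> #|I2| -> leigenspace (mx_endo J) lambda2 = Vset R I2 &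
          #|I1| = #|I2| ->
            leigenspace (mx_endo J) lambda2 = (Vset R I1 + Vset R I2)%VS] &
      (* (4) *)
      single_eigenvalue J (- 2 * eps)
      /\ leigenspace (mx_endo J) (- 2 * eps) = Vpair R I1 I2].
Proof.
move=> I1 I2 J lambda1 lambda2.
have I2E : ~: I1 = I2 by exact: setC_agree_set.
have I20 : I2 != set0.
  apply/eqP => I2_0; apply: xi12_neq; apply/colP => i.
  by move/setP/(_ i): I2_0; rewrite !inE => /negbFE/eqP.
(* Signs that differ at every index are opposite, which would give [xi1 = - xi2]. *)
have I10 : I1 != set0.
  apply/eqP => I1_0; apply: xi12_neqN; apply/colP => i; rewrite mxE.
  move/setP/(_ i): I1_0; rewrite !inE.
  by case: (xi1_sign i) (xi2_sign i) => -> [] ->; rewrite ?eqxx ?opprK.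
have N0 : (0 < N)%N by case/set0Pn: I10 => i _; case: (N) i => [[]|].
have JE : J = two_block eps I1 by exact: jacobian_two_block.
(* The form is invariant under complement, so (3) follows from the lemmas for (2) with the blocks
   exchanged. *)
have JE' : J = two_block eps I2 by rewrite JE -I2E two_blockC.
have I1E : ~: I2 = I1 by rewrite -I2E setCK.
have Jsym : J^T = J by rewrite JE tr_two_block.
have E0 : leigenspace (mx_endo J) 0 = Vone R N.
  by rewrite JE leigenspace_two_block_0.
have Epair : leigenspace (mx_endo J) (- 2 * eps) = Vpair R I1 I2.
  by rewrite JE -I2E leigenspace_two_block_pair // I2E.
split.
- split=> //; apply: single_eigenvalue_symmetric E0 => //.
  by apply/eqP => /colP/(_ (Ordinal N0))/eqP; rewrite !mxE oner_eq0.
- rewrite JE -I2E; split=> [|neqI|eqI]; first exact: leigenvalue_two_block.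
    exact: leigenspace_two_block_neq.
  by apply: leigenspace_two_block_eq; rewrite // I2E.
- rewrite JE' -I1E; split=> [|neqI|eqI]; first exact: leigenvalue_two_block.
    by apply: leigenspace_two_block_neq => //; exact/nesym.
  by rewrite addvC; apply: leigenspace_two_block_eq; rewrite // I1E.
- split=> //; rewrite /Vpair (negPf I10) (negPf I20) in Epair.
  apply: single_eigenvalue_symmetric Epair => //.
  case/set0Pn: I10 => i iI1; apply/eqP => /colP/(_ i)/eqP.
  by rewrite !mxE iI1 pnatr_eq0 cards_eq0 (negPf I20).
Qed.
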